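(* Let $n=n_1\times\cdots\times n_v$ and let $W$ be a known, deterministic, symmetric positive definite $n(n+1)/2\times n(n+1)/2$ matrix. For any $n\times n$ real symmetric positive definite matrix $\Sigma$ (a covariance or correlation matrix), there exists a unique matrix $L^0\in\mathcal{D}_n$ such that $$\|\log\Sigma-L^0\|_W=\min_{L\in\mathcal{D}_n}\|\log\Sigma-L\|_W.$$ Moreover $\Sigma^0:=\exp L^0$ is of Kronecker product form: $\Sigma^0=\Sigma_1^0\otimes\cdots\otimes\Sigma_v^0$ with each $\Sigma_j^0$ an $n_j\times n_j$ real symmetric positive definite matrix.
   Context: The $n_j\ge2$ are integers. $\log$ is the principal matrix logarithm. For $n\times n$ real symmetric $A$, $\mathrm{vech}A$ stacks the entries on and below the diagonal, and $\|A\|_W=\sqrt{(\mathrm{vech}A)^{\intercal}W\,\mathrm{vech}A}$. $\mathcal{D}_n$ is the set of matrices of the form $\Omega_1\otimes I_{n_2}\otimes\cdots\otimes I_{n_v}+I_{n_1}\otimes\Omega_2\otimes\cdots\otimes I_{n_v}+\cdots+I_{n_1}\otimes\cdots\otimes\Omega_v$, where each $\Omega_j$ is an $n_j\times n_j$ real symmetric matrix. *)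

(* Defs.v *)
From mathcomp Require Import all_boot all_order all_algebra.
From mathcomp Require Import complex mxtens.
From mathcomp Require Import boolp classical_sets reals topology normedtype.
From mathcomp Require Import sequences trigo.

Set Implicit Arguments.
Unset Strict Implicit.
Unset Printing Implicit Defensive.

Import Order.TTheory GRing.Theory Num.Theory.
Import numFieldNormedType.Exports.

Local Open Scope classical_set_scope.
Local Open Scope ring_scope.

Definition symmx (R : Type) n (A : 'M[R]_n) : Prop := A^T = A.

Definition posdefmx (R : numDomainType) n (A : 'M[R]_n) : Prop :=
  symmx A /\ forall x : 'cV[R]_n, x != 0 -> 0 < (x^T *m A *m x) 0 0.

Definition expm (R : realType) n (A : 'M[R]_n) : 'M[R]_n :=
  limn (series (fun k => k`!%:R^-1 *: A ^+ k)).

(* [X] is a principal logarithm of [A]: [expm X = A], and the complex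
   eigenvalues of [X] all lie in the open strip [-pi < Im z < pi]. If [A] has
   no eigenvalue in the closed half-line of nonpositive reals, in particular
   if [A] is symmetric positive definite, there is exactly one such [X], and
   the choice in [logm] selects it. *)
Definition principal_log (R : realType) n (A X : 'M[R]_n) : Prop :=
  expm X = A /\
  forall z : R[i], eigenvalue (map_mx (real_complex R) X) z ->
    - pi < complex.Im z < pi.

Definition logm (R : realType) n (A : 'M[R]_n) : 'M[R]_n :=
  get [set X | principal_log A X].

(* The entries [A i j] with [j <= i], in column-major order:
   A 0 0, ..., A (n-1) 0, A 1 1, ..., A (n-1) 1, ..., A (n-1) (n-1). *)
Definition vech_seq (R : Type) n (A : 'M[R]_n) : seq R :=
  [seq A i j | j : 'I_n <- enum 'I_n,
               i : 'I_n <- [seq i : 'I_n <- enum 'I_n | (j <= i)%N]].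

(* Hence the default [0] of [`_k] in [vech] is never used. *)
Lemma size_vech_seq (R : Type) n (A : 'M[R]_n) :
  size (vech_seq A) = ((n * n.+1) %/ 2)%N.
Proof.
rewrite size_allpairs_dep sumnE big_map big_enum /=.
transitivity (\sum_(j < n) (n - j))%N.
  apply: eq_bigr => j _; rewrite size_filter.
  rewrite -(count_map (@nat_of_ord n) (leq j)) val_enum_ord.
  rewrite -[X in iota _ X](subnKC (ltnW (ltn_ord j))) iotaD count_cat add0n.
  rewrite (@eq_in_count _ _ pred0) ?count_pred0; last first.
    by move=> k; rewrite mem_iota add0n /= => lt_kj; rewrite leqNgt lt_kj.
  rewrite (@eq_in_count _ _ predT) ?count_predT ?size_iota //.
  by move=> k; rewrite mem_iota => /andP[->].
rewrite (reindex_inj rev_ord_inj) /=.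
under eq_bigr => j _ do rewrite subKn //.
by rewrite divn2 mulnC -bin2 -bin2_sum big_mkord big_ord_recl add0n.
Qed.

Definition vech (R : nmodType) n (A : 'M[R]_n) : 'cV[R]_((n * n.+1) %/ 2) :=
  \col_k (vech_seq A)`_k.

Definition wnorm (R : rcfType) n (W : 'M[R]_((n * n.+1) %/ 2)) (A : 'M[R]_n)
    : R :=
  Num.sqrt (((vech A)^T *m W *m vech A) 0 0).

Fixpoint kdim (v : nat) : ('I_v -> nat) -> nat :=
  match v with
  | 0 => fun _ => 1%N
  | v'.+1 => fun n => (n ord0 * kdim (fun j : 'I_v' => n (lift ord0 j)))%N
  end.

Lemma kdimE v (n : 'I_v -> nat) : kdim n = (\prod_(j < v) n j)%N.
Proof.
by elim: v n => [|v IHv] n; rewrite ?big_ord0 // big_ord_recl /= IHv.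
Qed.

(* [kron A] is A_0 (x) A_1 (x) ... (x) A_(v-1); [kdim] is the recursive form
   of the product of the sizes that makes this typecheck without casts. *)
Fixpoint kron (R : pzRingType) (v : nat) :
    forall n : 'I_v -> nat, (forall j, 'M[R]_(n j)) -> 'M[R]_(kdim n) :=
  match v with
  | 0 => fun _ _ => 1%:M
  | v'.+1 => fun n A =>
      tensmx (A ord0)
        (@kron R v' (fun j => n (lift ord0 j)) (fun j => A (lift ord0 j)))
  end.

Definition kron_sum (R : pzRingType) v (n : 'I_v -> nat)
    (Omega : forall j, 'M[R]_(n j)) : 'M[R]_(kdim n) :=
  \sum_(j < v) kron (fun i => if i == j then Omega i else 1%:M).

Definition kron_sum_space (R : pzRingType) v (n : 'I_v -> nat) :
    set 'M[R]_(kdim n) :=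
  [set L | exists Omega : forall j, 'M[R]_(n j),
     (forall j, symmx (Omega j)) /\ L = kron_sum Omega].

Definition minimizer (R : realType) n (W : 'M[R]_((n * n.+1) %/ 2))
    (A : 'M[R]_n) (D : set 'M[R]_n) (L0 : 'M[R]_n) : Prop :=
  D L0 /\ forall L, D L -> wnorm W (A - L0) <= wnorm W (A - L).

(* Main.v *)
Require Import Defs.
From mathcomp Require Import all_boot all_order all_algebra.
From mathcomp Require Import complex mxtens spectral.
From mathcomp Require Import boolp classical_sets reals topology normedtype.
From mathcomp Require Import sequences exp.

Set Implicit Arguments.
Unset Strict Implicit.
Unset Printing Implicit Defensive.

Import Order.TTheory GRing.Theory Num.Theory.
Import numFieldNormedType.Exports.

Local Open Scope classical_set_scope.
Local Open Scope ring_scope.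

(** The map [vech] is linear, and injective on symmetric matrices, so the
[W]-norm turns the problem into the least-squares approximation of the vector
[vech (logm Sigma)] by a linear subspace of a finite-dimensional space with the
inner product [W]. The orthogonal projection [orthogonal_projection] together
with Pythagoras gives existence and uniqueness of the minimizer, for any target
matrix ([unique_minimizer]).

The minimizer is a Kronecker sum of symmetric matrices [Omega j]. The summands
commute, so its exponential is the Kronecker product of the [expm (Omega j)].
Here this is reduced to the scalar exponential by diagonalization. A real
symmetric matrix is [V *m diag_mx d *m P] with [P *m V = 1%:M]
([symmx_diagonalizable]), its exponential is [V *m diag_mx (exp d) *m P]
([expm_diagonalizable]), and if [A] and [B] have diagonal forms [d] and [e],
then [A (x) 1 + 1 (x) B] is diagonalized by the tensor products of the bases,
with diagonal entries [d i + e j], so that [expRD] yields [expm_tensmx].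
Induction on the number of factors gives [expm_kron_sum]. Finally, [expm A] is
the square of the symmetric invertible matrix [expm (A / 2)], hence positive
definite ([expm_posdefmx]). *)

(** * Diagonalization and exponential of real symmetric matrices *)

(** Over [R[i]] the matrix is Hermitian, hence unitarily similar to a real
diagonal matrix. Two real matrices similar over the complex numbers are similar
over the reals, so the change of basis can be taken real. It is not
made orthogonal, so the symmetry of the exponential is a separate fact,
[expm_symmx]. *)
Lemma symmx_diagonalizable (R : rcfType) n (A : 'M[R]_n) : symmx A ->
  exists P V : 'M[R]_n, exists d : 'rV[R]_n,
    P *m V = 1%:M /\ A = V *m diag_mx d *m P.
Proof.
move=> Asym; pose toC := real_complex R; pose AC : 'M[R[i]]_n := map_mx toC A.
have realC m p (B : 'M[R]_(m, p)) : map_mx toC B \is a mxOver Num.real.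
  by apply/mxOverP => i j; rewrite mxE; apply/complex_realP; exists (B i j).
have AC_herm : AC \is hermsymmx.
  apply/is_hermitianmxP; rewrite expr0 scale1r -map_trmx.
  by rewrite (realmxC (realC _ _ A)) map_trmx Asym.
have d_real := hermitian_spectral_diag_real AC_herm.
have /orthomx_spectralP AC_eq := hermitian_normalmx AC_herm.
set D := spectral_diag AC in AC_eq d_real.
pose d : 'rV[R]_n := map_mx (@complex.Re R) D.
have dE : map_mx toC d = D.
  by apply/matrixP => i j; rewrite !mxE; apply: RRe_real; exact: (mxOverP d_real).
have [Q /andP[Qreal Qunit]] :
    similar_in [predI mxOver Num.real & unitmx] AC (diag_mx D).
  apply: real_similar.
  - exists (spectralmx AC); first exact: spectral_unit.
    apply/similarP; first exact: spectral_unit.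
    by rewrite {2}AC_eq !mulmxA mulmxV ?mul1mx// spectral_unit.
  - exact: realC.
  - by rewrite -dE -map_diag_mx realC.
move=> /(similarP Qunit) QA.
pose P : 'M[R]_n := map_mx (@complex.Re R) Q.
have PE : map_mx toC P = Q.
  by apply/matrixP => i j; rewrite !mxE; apply: RRe_real; exact: (mxOverP Qreal).
have Punit : P \in unitmx by rewrite -(map_unitmx toC) PE.
exists P, (invmx P), d; split; first exact: mulmxV.
have PA : P *m A = diag_mx d *m P.
  apply: (map_mx_inj (f := toC)).
  by rewrite !map_mxM PE QA map_diag_mx dE.
by rewrite -mulmxA -PA mulmxA mulVmx// mul1mx.
Qed.

Lemma mx_cvg (R : realFieldType) m n (u : nat -> 'M[R]_(m, n))
    (M : 'M[R]_(m, n)) :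
  (forall i j, (fun k => u k i j) @ \oo --> M i j) -> u @ \oo --> M.
Proof.
move=> uM; apply/cvgrPdist_le => /= e e0; near=> k.
rewrite /Num.Def.normr/= mx_normrE (bigmax_le _ (ltW e0))//= => -[i j] _.
rewrite !mxE/=; move: i j; near: k.
apply: filter_forall => i; apply: filter_forall => j.
exact: ((cvgrPdist_le _ _).1 (uM i j)).
Unshelve. all: by end_near. Qed.

Lemma diag_mxX (R : pzRingType) n (d : 'rV[R]_n) k :
  diag_mx d ^+ k = diag_mx (map_mx (fun x => x ^+ k) d).
Proof.
elim: k => [|k IHk].
  by apply/matrixP => i j; rewrite !mxE.
by rewrite exprS IHk [LHS]mulmx_diag; congr diag_mx; apply/rowP => i;
  rewrite !mxE exprS.
Qed.

Lemma conj_mxX (R : comPzRingType) n (P V A : 'M[R]_n) k : P *m V = 1%:M ->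
  (V *m A *m P) ^+ k = V *m A ^+ k *m P.
Proof.
move=> PV; elim: k => [|k IHk].
  by rewrite !expr0 mulmx1 (mulmx1C PV).
by rewrite !exprS IHk -[X in X = _]/(_ *m _) -[A * _]/(A *m _) -!mulmxA
  (mulmxA P) PV mul1mx.
Qed.

(** The powers of [V *m diag_mx d *m P] are [V *m diag_mx (d ^+ k) *m P], so each
entry of a partial sum is a fixed linear combination of partial sums of the
scalar exponential series at the [d 0 l]. *)
Lemma expm_diagonalizable (R : realType) n (P V : 'M[R]_n) (d : 'rV[R]_n) :
  P *m V = 1%:M ->
  expm (V *m diag_mx d *m P) = V *m diag_mx (map_mx expR d) *m P.
Proof.
move=> PV; apply: cvg_lim => //; apply: mx_cvg => i j.
have entry (c : 'rV[R]_n) :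
    (V *m diag_mx c *m P) i j = \sum_l V i l * c 0 l * P l j.
  rewrite mul_mx_diag mxE; apply: eq_bigr => l _; rewrite !mxE; congr (_ * _).
have -> : (fun k => series (fun k => k`!%:R^-1 *:
    (V *m diag_mx d *m P) ^+ k) k i j) =
    (fun k => \sum_l V i l * series (exp_coeff (d 0 l)) k * P l j).
  apply/funext => k; rewrite /series/= summxE.
  under [RHS]eq_bigr do rewrite mulr_sumr mulr_suml.
  rewrite exchange_big; apply: eq_bigr => m _ /=.
  rewrite conj_mxX// diag_mxX mxE entry mulr_sumr; apply: eq_bigr => l _.
  by rewrite mxE /exp_coeff/= [in RHS](mulrC (_ ^+ _)) !mulrA [V _ _ * _]mulrC.
rewrite entry; apply: cvg_big => [|l _]; first exact: add_continuous.
apply: cvgMr_tmp; apply: cvgMl_tmp; rewrite mxE; exact: is_cvg_series_exp_coeff.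
Qed.

(** Transposing [A = V *m diag_mx d *m P] gives a second diagonal form of the same
matrix, with [P^T] and [V^T] exchanged; [expm] is computed in both. *)
Lemma expm_symmx (R : realType) n (A : 'M[R]_n) : symmx A -> symmx (expm A).
Proof.
move=> Asym; have [P [V [d [PV AE]]]] := symmx_diagonalizable Asym.
rewrite /symmx -{2}Asym AE !trmx_mul tr_diag_mx mulmxA.
by rewrite !expm_diagonalizable ?trmx_mul ?tr_diag_mx ?mulmxA //
  -trmx_mul PV trmx1.
Qed.

Lemma sqnorm_gt0 (R : realDomainType) n (y : 'cV[R]_n) :
  y != 0 -> 0 < (y^T *m y) 0 0.
Proof.
have yyE : (y^T *m y) 0 0 = \sum_i y i 0 ^+ 2.
  by rewrite mxE; apply: eq_bigr => i _; rewrite mxE.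
have yy_ge0 i : true -> 0 <= y i 0 ^+ 2 by rewrite sqr_ge0.
move=> y0; rewrite lt0r yyE sumr_ge0// andbT; apply: contra_neqN y0.
rewrite psumr_eq0// => /allP y0; apply/colP => i; rewrite mxE.
by apply/eqP; rewrite -sqrf_eq0 (implyP (y0 i _)) ?mem_index_enum.
Qed.

(** With [E c = expm (c *: A)], the law [E a *m E b = E (a + b)] shows that [expm A]
is the square of the symmetric matrix [E 2^-1], whose inverse is [E (- 2^-1)]. *)
Lemma expm_posdefmx (R : realType) n (A : 'M[R]_n) :
  symmx A -> posdefmx (expm A).
Proof.
move=> Asym; split; first exact: expm_symmx.
have [P [V [d [PV AE]]]] := symmx_diagonalizable Asym.
pose E c := V *m diag_mx (map_mx expR (c *: d)) *m P.
have expmE c : expm (c *: A) = E c.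
  by rewrite AE /E -expm_diagonalizable// linearZ/= -scalemxAr -scalemxAl.
have ED a b : E a *m E b = E (a + b).
  rewrite /E -!mulmxA (mulmxA P) PV mul1mx (mulmxA (diag_mx _)) mulmx_diag.
  by do 3!f_equal; apply/rowP => i; rewrite !mxE mulrDl expRD.
have E0 : E 0 = 1%:M.
  rewrite /E scale0r (_ : map_mx _ _ = const_mx 1) ?diag_const_mx ?mulmx1.
    exact: mulmx1C.
  by apply/rowP => i; rewrite !mxE expR0.
have Esym : (E 2^-1)^T = E 2^-1.
  by rewrite -expmE; apply: expm_symmx; rewrite /symmx linearZ/= Asym.
have -> : expm A = E 2^-1 *m E 2^-1.
  by rewrite ED -[2^-1 in RHS]mul1r -splitr -expmE scale1r.
move=> x x0; rewrite -{1}Esym mulmxA -trmx_mul -mulmxA; apply: sqnorm_gt0.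
apply: contra_neq x0 => Ex0.
by rewrite -[x]mul1mx -E0 -(addNr 2^-1) -ED -mulmxA Ex0 mulmx0.
Qed.

(** * Exponential of a Kronecker sum *)

Lemma tensmx_linearl (R : pzRingType) m n p q (B : 'M[R]_(p, q)) a
    (A A' : 'M[R]_(m, n)) :
  tensmx (a *: A + A') B = a *: tensmx A B + tensmx A' B.
Proof. by apply/matrixP => i j; rewrite !mxE mulrDl mulrA. Qed.

Lemma tensmxDr (R : pzRingType) m n p q (A : 'M[R]_(m, n))
    (B B' : 'M[R]_(p, q)) :
  tensmx A (B + B') = tensmx A B + tensmx A B'.
Proof. by apply/matrixP => i j; rewrite !mxE mulrDr. Qed.

Lemma tensmxZr (R : comPzRingType) m n p q a (A : 'M[R]_(m, n))
    (B : 'M[R]_(p, q)) :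
  tensmx A (a *: B) = a *: tensmx A B.
Proof. by apply/matrixP => i j; rewrite !mxE mulrCA. Qed.

Lemma tensmx_diag (R : pzRingType) m n (d : 'rV[R]_m) (e : 'rV[R]_n) :
  tensmx (diag_mx d) (diag_mx e) =
  diag_mx (\row_k (d 0 (mxtens_unindex k).1 * e 0 (mxtens_unindex k).2)).
Proof.
apply/matrixP => i j; case: (mxtens_indexP i) => i1 i2.
case: (mxtens_indexP j) => j1 j2; rewrite tensmxE !mxE mxtens_indexK /=.
rewrite (can_eq (@mxtens_indexK _ _)) xpair_eqE.
by case: (i1 == j1); case: (i2 == j2); rewrite /= ?mulr1n ?mulr0n ?mulr0 ?mul0r.
Qed.

Lemma tensmx1 (R : pzRingType) m n :
  tensmx (1%:M : 'M[R]_m) (1%:M : 'M[R]_n) = 1%:M.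
Proof.
rewrite -!diag_const_mx tensmx_diag; congr diag_mx.
by apply/rowP => k; rewrite !mxE mulr1.
Qed.

(** If [P *m V = 1] and [Q *m U = 1] diagonalize [A] and [B], then [tensmx P Q] and
[tensmx V U] diagonalize both tensor products at once, and the eigenvalues add. *)
Lemma expm_tensmx (R : realType) m n (A : 'M[R]_m) (B : 'M[R]_n) :
  symmx A -> symmx B ->
  expm (tensmx A 1%:M + tensmx 1%:M B) = tensmx (expm A) (expm B).
Proof.
move=> /symmx_diagonalizable[P [V [d [PV ->]]]].
move=> /symmx_diagonalizable[Q [U [e [QU ->]]]].
have PQVU : tensmx P Q *m tensmx V U = 1%:M by rewrite tensmx_mul PV QU tensmx1.
rewrite -{1}(mulmx1C PV) -{1}(mulmx1C QU).
rewrite -[in V *m P](mulmx1 V) -[in U *m Q](mulmx1 U) -!diag_const_mx.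
rewrite -!tensmx_mul -mulmxDl -mulmxDr !tensmx_diag -linearD /=.
rewrite !expm_diagonalizable// -!tensmx_mul tensmx_diag.
congr (_ *m diag_mx _ *m _); apply/rowP => k.
by rewrite !mxE mulr1 mul1r expRD.
Qed.

Lemma eq_kron (R : pzRingType) v (n : 'I_v -> nat)
    (A B : forall j, 'M[R]_(n j)) :
  (forall j, A j = B j) -> kron A = kron B.
Proof.
by elim: v n A B => //= v IHv n A B AB; rewrite AB; congr tensmx; apply: IHv.
Qed.

Lemma kron1 (R : pzRingType) v (n : 'I_v -> nat) :
  kron (fun j => 1%:M : 'M[R]_(n j)) = 1%:M.
Proof. by elim: v n => //= v IHv n; rewrite IHv tensmx1. Qed.

(** The recursion that reduces statements on Kronecker sums to two factors. *)
Lemma kron_sum_recl (R : pzRingType) v (n : 'I_v.+1 -> nat)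
    (Omega : forall j, 'M[R]_(n j)) :
  kron_sum Omega = tensmx (Omega ord0) 1%:M +
    tensmx 1%:M (kron_sum (fun j => Omega (lift ord0 j))).
Proof.
rewrite /kron_sum big_ord_recl /=; congr (tensmx _ _ + _).
  exact: kron1.
rewrite (big_morph _ (tensmxDr 1%:M) (tensmx0 1%:M)); apply: eq_bigr => j _.
by congr tensmx; apply: eq_kron.
Qed.

Lemma kron_sum_linear (R : comPzRingType) v (n : 'I_v -> nat) a
    (Omega Omega' : forall j, 'M[R]_(n j)) :
  kron_sum (fun j => a *: Omega j + Omega' j) =
  a *: kron_sum Omega + kron_sum Omega'.
Proof.
elim: v n Omega Omega' => [|v IHv] n Omega Omega'.
  by rewrite /kron_sum !big_ord0 scaler0 addr0.
rewrite !kron_sum_recl IHv tensmx_linearl tensmxDr tensmxZr scalerDr.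
by rewrite addrACA.
Qed.

Lemma kron_sum_symmx (R : pzRingType) v (n : 'I_v -> nat)
    (Omega : forall j, 'M[R]_(n j)) :
  (forall j, symmx (Omega j)) -> symmx (kron_sum Omega).
Proof.
elim: v n Omega => [|v IHv] n Omega Osym.
  by rewrite /symmx /kron_sum big_ord0 trmx0.
by rewrite /symmx kron_sum_recl linearD/= !trmx_tens !trmx1 Osym IHv.
Qed.

Lemma expm_kron_sum (R : realType) v (n : 'I_v -> nat)
    (Omega : forall j, 'M[R]_(n j)) : (forall j, symmx (Omega j)) ->
  expm (kron_sum Omega) = kron (fun j => expm (Omega j)).
Proof.
elim: v n Omega => [|v IHv] n Omega Osym.
  rewrite /kron_sum big_ord0 /=.
  (* With no factor the sum is the 1 x 1 zero matrix and the product is 1. *)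
  have := @expm_diagonalizable R 1 1%:M 1%:M 0 (mulmx1 _).
  rewrite mulmx1 mul1mx mulmx1 mul1mx linear0 => ->.
  rewrite -diag_const_mx; congr diag_mx.
  by apply/rowP => i; rewrite !mxE expR0.
by rewrite kron_sum_recl expm_tensmx ?IHv//; apply: kron_sum_symmx.
Qed.

(** * Least squares on a linear space of symmetric matrices *)

(** A matrix of maximal rank among those whose row space lies in [S] spans [S]: a
vector of [S] outside its row space could be added to increase the rank. *)
Lemma linear_set_rowspace (F : fieldType) N (S : set 'rV[F]_N) :
  S 0 -> (forall a x y, S x -> S y -> S (a *: x + y)) ->
  exists U : 'M[F]_N, forall x, S x <-> (x <= U)%MS.
Proof.
move=> S0 Slin.
pose inS (U : 'M[F]_N) := forall x : 'rV[F]_N, (x <= U)%MS -> S x.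
pose rk k := `[< exists U, inS U /\ \rank U = k >].
have rk0 : exists k, rk k.
  exists 0%N; apply/asboolP; exists 0; split; last exact: mxrank0.
  by move=> x; rewrite submx0 => /eqP ->.
have rkN k : rk k -> (k <= N)%N.
  by move=> /asboolP[U [_ <-]]; exact: rank_leq_row.
have [_ /asboolP[U [US <-]] Umax] := ex_maxnP rk0 rkN.
exists U => x; split=> [Sx|]; last exact: US.
have UxS : inS (U + x)%MS.
  move=> y /sub_addsmxP[[u c] /= ->]; rewrite (mx11_scalar c) mul_scalar_mx.
  by rewrite addrC; apply: Slin => //; apply: US; exact: submxMl.
have := Umax _ (introT (asboolP _) (ex_intro _ _ (conj UxS erefl))).
move=> rkUx; apply: submx_trans (addsmxSr U x) _.
by rewrite -(geq_leqif (mxrank_leqif_sup (addsmxSl U x))).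
Qed.

(** With [B] a basis of the row space of [U], the Gram matrix [B *m W *m B^T] is
invertible because [W] is positive definite, and the normal equations have the
explicit solution [p = B^T *m G^-1 *m B *m W *m a]. *)
Lemma orthogonal_projection (F : realFieldType) N (W U : 'M[F]_N) (a : 'cV[F]_N) :
  posdefmx W -> exists2 p : 'cV[F]_N, (p^T <= U)%MS &
    forall y : 'cV[F]_N, (y^T <= U)%MS -> y^T *m W *m (a - p) = 0.
Proof.
move=> [Wsym Wpos].
move: (row_base U) (row_base_free U) (eq_row_base U) => B Bfree BU.
pose G := B *m W *m B^T.
have Gunit : G \in unitmx.
  rewrite -row_free_unit -kermx_eq0; apply/eqP/row_matrixP => i; rewrite row0.
  have : row i (kermx G) *m G = 0 by rewrite -row_mul mulmx_ker row0.
  set k := row i _; rewrite /G !mulmxA => kG0.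
  apply/eqP; rewrite -(mulmx_free_eq0 _ Bfree).
  rewrite -trmx_eq0; apply/negPn/negP => /Wpos.
  by rewrite trmxK trmx_mul !mulmxA kG0 mul0mx mxE ltxx.
exists (B^T *m invmx G *m (B *m W *m a)).
  rewrite !trmx_mul trmxK !mulmxA.
  by apply: submx_trans (submxMl _ _) _; rewrite BU.
move=> y yU; have /submxP[c ->] : (y^T <= B)%MS by rewrite BU.
rewrite mulmxBr !mulmxA -(mulmxA c B) -(mulmxA c _ B^T) -/G.
by rewrite mulmxK// !mulmxA subrr.
Qed.

Lemma pythagoras (F : numDomainType) N (W : 'M[F]_N) (x y : 'cV[F]_N) :
  symmx W -> y^T *m W *m x = 0 ->
  ((x + y)^T *m W *m (x + y)) 0 0 =
    (x^T *m W *m x) 0 0 + (y^T *m W *m y) 0 0.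
Proof.
move=> Wsym yWx; have xWy : x^T *m W *m y = 0.
  by apply: trmx_inj; rewrite !trmx_mul trmxK Wsym mulmxA yWx trmx0.
by rewrite [(x + y)^T]linearD/= !mulmxDl !mulmxDr xWy yWx addr0 add0r mxE.
Qed.

(** The positions read by [vech_seq] do not depend on the matrix: they are
[vech_seq] of the matrix of index pairs. *)
Lemma vech_seqE (R : Type) n (A : 'M[R]_n) : vech_seq A =
  [seq A p.1 p.2 | p <- vech_seq (\matrix_(i, j) (i, j))].
Proof.
by rewrite map_allpairs; apply: eq_allpairs => j i; rewrite mxE.
Qed.

Lemma vech_linear (R : pzRingType) n a (A B : 'M[R]_n) :
  vech (a *: A + B) = a *: vech A + vech B.
Proof.
apply/colP => k; rewrite !mxE !(vech_seqE (_ + _)) (vech_seqE A) (vech_seqE B).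
have ltk : (k < size (vech_seq (\matrix_(i < n, j < n) (i, j))))%N.
  by rewrite size_vech_seq.
case E : (vech_seq _) ltk => [//|p0 s]; rewrite -E => ltk.
by rewrite !(nth_map p0)// !mxE.
Qed.

Lemma vech_inj (R : nmodType) n (A B : 'M[R]_n) :
  symmx A -> symmx B -> vech A = vech B -> A = B.
Proof.
move=> Asym Bsym AB.
have AB_low (i j : 'I_n) : (j <= i)%N -> A i j = B i j.
  have : vech_seq A = vech_seq B.
    apply: (@eq_from_nth _ 0) => [|k]; first by rewrite !size_vech_seq.
    rewrite size_vech_seq => ltk.
    by have /colP/(_ (Ordinal ltk)) := AB; rewrite !mxE.
  move=> /eq_in_allpairs_dep ABij leji.
  by apply: ABij; [rewrite mem_enum|rewrite mem_filter leji mem_enum].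
apply/matrixP => i j; have [/AB_low//|/ltnW/AB_low ABji] := leqP j i.
by rewrite -Asym -Bsym !mxE.
Qed.

(** The candidate is the matrix of [D] whose [vech] is the [W]-orthogonal projection
of [vech A]; [vech_inj] makes it unique. *)
Lemma unique_minimizer (R : realType) n (W : 'M[R]_((n * n.+1) %/ 2))
    (A : 'M[R]_n) (D : set 'M[R]_n) :
  posdefmx W -> D 0 -> (forall a X Y, D X -> D Y -> D (a *: X + Y)) ->
  (forall X, D X -> symmx X) ->
  exists L0, unique (minimizer W A D) L0.
Proof.
move=> Wpos D0 Dlin Dsym; have [Wsym W_gt0] := Wpos.
pose q (x : 'cV[R]_((n * n.+1) %/ 2)) := (x^T *m W *m x) 0 0.
have q_ge0 x : 0 <= q x.
  have [->|/W_gt0/ltW//] := eqVneq x 0.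
  by rewrite /q mulmx0 mxE.
have vechB (X Y : 'M[R]_n) : vech (X - Y) = vech X - vech Y.
  by rewrite addrC -(scaleN1r Y) vech_linear scaleN1r addrC.
have vech0 : vech (0 : 'M[R]_n) = 0 by rewrite -(subrr 0) vechB subrr.
have [||U UP] := @linear_set_rowspace _ _ [set (vech X)^T | X in D].
- by exists 0; rewrite // vech0 trmx0.
- move=> a _ _ [X DX <-] [Y DY <-]; exists (a *: X + Y); first exact: Dlin.
  by rewrite vech_linear linearP.
have [p /UP[L0 DL0 /trmx_inj L0p] p_orth] :=
  orthogonal_projection U (vech A) Wpos.
have qE L : D L ->
    q (vech (A - L)) = q (vech (A - L0)) + q (vech (L0 - L)).
  move=> DL; rewrite /q -pythagoras//.
    by rewrite -[vech (A - L0)]scale1r -vech_linear scale1r addrA subrK.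
  rewrite [vech (A - L0)]vechB L0p; apply: p_orth.
  apply/UP; exists (L0 - L) => //.
  by rewrite addrC -(scaleN1r L); apply: Dlin.
have L0min : minimizer W A D L0.
  split=> // L DL; rewrite /wnorm ler_sqrt ?q_ge0// -/(q _) -/(q _) (qE L)//.
  by rewrite lerDl q_ge0.
exists L0; split=> // L [DL /(_ _ DL0)].
rewrite /wnorm ler_sqrt ?q_ge0// -/(q _) -/(q _) (qE L)// gerDl => qL.
apply: vech_inj; [exact: Dsym|exact: Dsym|apply/eqP].
rewrite -subr_eq0 -vechB; apply/negPn/negP => /W_gt0.
by rewrite ltNge qL.
Qed.

(** * The closest Kronecker sum to the logarithm *)

Theorem mainTheorem9 (R : realType) (v : nat) (n : 'I_v -> nat)
    (hv : (0 < v)%N) (hn : forall j : 'I_v, (2 <= n j)%N)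
    (W : 'M[R]_((kdim n * (kdim n).+1) %/ 2)) (hW : posdefmx W)
    (Sigma : 'M[R]_(kdim n)) (hSigma : posdefmx Sigma) :
  exists L0 : 'M[R]_(kdim n),
    unique (minimizer W (logm Sigma) (@kron_sum_space R v n)) L0 /\
    exists Sigma0 : forall j : 'I_v, 'M[R]_(n j),
      (forall j : 'I_v, posdefmx (Sigma0 j)) /\ expm L0 = kron Sigma0.
Proof.
have [||||L0 L0min] :=
  @unique_minimizer R _ W (logm Sigma) (@kron_sum_space R v n).
- exact: hW.
(* Zero is written as a linear combination so that kron_sum_linear applies. *)
- exists (fun j => -1 *: 0 + 0); split=> [j|].
    by rewrite /symmx scaler0 addr0 trmx0.
  by rewrite kron_sum_linear scaleN1r addNr.
- move=> a _ _ [X [Xsym ->]] [Y [Ysym ->]].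
  exists (fun j => a *: X j + Y j); split=> [j|]; last by rewrite kron_sum_linear.
  by rewrite /symmx linearP/= Xsym Ysym.
- by move=> _ [Omega [Osym ->]]; exact: kron_sum_symmx.
exists L0; split=> //; have [[[Omega [Osym ->]] _] _] := L0min.
exists (fun j => expm (Omega j)); split=> [j|]; first exact: expm_posdefmx.
exact: expm_kron_sum.
Qed.
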